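(* Consider the (static) lowest unique bid auction game with $n$ bidders, object value $v$ and bidding cost $c>0$. If $n\ge 3$ and $v>\max\{2c+2,10\}$, then there is no symmetric Nash equilibrium in monotone strategies; that is, there is no monotone mixed strategy $\sigma$ such that the profile $(\sigma,\dots,\sigma)$ is a Nash equilibrium.
   Context: The lowest unique bid auction game: there is an object of common value $v>0$ (a real number), a bidding cost $c>0$ (a real number), and a set of bidders $\mathcal{B}=\{1,\dots,n\}$. Here $\mathbb{N}$ denotes the positive integers. Simultaneously and independently, each bidder $i$ submits a finite (possibly empty) set $S_i\subset\mathbb{N}$ of bids. Let $S_*=\{s\in\mathbb{N}: \#\{i\in\mathcal{B}: s\in S_i\}=1\}$ be the set of integers bid by exactly one bidder. If $S_*=\varnothing$ there is no winner. If $S_*\neq\varnothing$, the winning bid is $s_*=\min(S_* )$ and the winner $i_*$ is the unique bidder with $s_*\in S_{i_*}$. The payoff of bidder $i$ is $u_i(S_1,\dots,S_n)=-c|S_i|+v-s_*$ if $i$ is the winner, and $u_i(S_1,\dots,S_n)=-c|S_i|$ otherwise. A pure strategy is a finite subset of $\mathbb{N}$; a mixed strategy $\sigma$ is a probability distribution over pure strategies. Bidders maximize expected payoff, and ''equilibrium'' means Nash equilibrium in mixed strategies (deviations to arbitrary strategies, not only monotone ones, are allowed). A mixed strategy is monotone if every set in its support is of the form $\{1,2,\dots,k\}$ for some integer $k\ge 0$ (where $k=0$ gives the empty set, i.e. not participating). *)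

(* Defs.v *)
From HB Require Import structures.
From mathcomp Require Import all_boot all_order all_algebra finmap.
From mathcomp Require Import all_classical all_reals all_analysis.

Set Implicit Arguments.
Unset Strict Implicit.
Unset Printing Implicit Defensive.

Import Order.TTheory GRing.Theory Num.Theory.

Local Open Scope ring_scope.

Notation bid := {k : nat | (0 < k)%N}.
Notation pure_strategy := {fset bid}.
Notation profile n := {ffun 'I_n -> pure_strategy}.

(* S_*: a bid made by exactly one bidder belongs to the union of all the S i, so
   ranging over that finite union loses nothing. *)
Definition unique_bids (n : nat) (S : profile n) : {fset bid} :=
  [fset s in (\bigcup_(i <- enum 'I_n) S i)%fset
     | #|[pred i : 'I_n | s \in S i]| == 1%N]%fset.

Definition winning_bid (n : nat) (S : profile n) : option bid :=
  omap val [pick s : unique_bids S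
             | [forall t : unique_bids S, (val (val s) <= val (val t))%N]].

Definition payoff (R : realType) (n : nat) (v c : R) (i : 'I_n)
    (S : profile n) : R :=
  let cost := c * #|` S i |%:R in
  if winning_bid S is Some s then
    if s \in S i then - cost + v - (val s)%:R else - cost
  else - cost.

Record mixed_strategy (R : realType) := MixedStrategy {
  prob :> pure_strategy -> R ;
  prob_ge0 : forall S, 0 <= prob S ;
  prob_sum1 : (\esum_(S in [set: pure_strategy]%classic) (prob S)%:E = 1)%E }.

Definition profile_prob (R : realType) (n : nat)
    (sigma : 'I_n -> mixed_strategy R) (S : profile n) : R :=
  \prod_(i < n) sigma i (S i).

(* [esum] is only meaningful for nonnegative families, so the expectation is
   the difference of those of the positive and negative parts. For 0 < c and
   0 < v payoffs are bounded above by v, so the first one is finite and the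
   expectation is well defined in [-oo, +oo[; it is -oo when the negative part
   diverges. *)
Definition expected_payoff (R : realType) (n : nat) (v c : R)
    (sigma : 'I_n -> mixed_strategy R) (i : 'I_n) : \bar R :=
  (\esum_(S in [set: profile n]%classic)
      (profile_prob sigma S * Num.max (payoff v c i S) 0)%:E
   - \esum_(S in [set: profile n]%classic)
      (profile_prob sigma S * Num.max (- payoff v c i S) 0)%:E)%E.

Definition deviate (R : realType) (n : nat) (sigma : 'I_n -> mixed_strategy R)
    (i : 'I_n) (tau : mixed_strategy R) : 'I_n -> mixed_strategy R :=
  fun j => if j == i then tau else sigma j.

Definition nash_equilibrium (R : realType) (n : nat) (v c : R)
    (sigma : 'I_n -> mixed_strategy R) : Prop :=
  forall (i : 'I_n) (tau : mixed_strategy R),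
    (expected_payoff v c (deviate sigma i tau) i
       <= expected_payoff v c sigma i)%E.

Definition monotone_strategy (R : realType) (sigma : mixed_strategy R) : Prop :=
  forall S : pure_strategy, sigma S != 0 ->
    exists k : nat, forall s : bid, (s \in S) = (val s <= k)%N.

(* Main.v *)
(* Write N = n - 1 and p_k for the probability of {1, ..., k} under sigma. If
   p_k = 0, then bidding on k+1 in addition to 1, ..., k never wins anything, so
   p_(k+1) = 0: the support is an initial segment. Hence 0 is in it, the
   equilibrium payoff is 0, and v > 2c + 2 forces 1 and 2 into it. Indifference
   between {}, {1} and {1, 2} gives c = (v - 1) p_0^N and
   2c >= (v - 2) (p_0 + p_1)^N + p_0^N. Playing {2} instead of {1, 2} saves c and
   loses only if nobody else participates, or if exactly one opponent plays {1};
   that it is not profitable means p_0 <= N p_1. Then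
   (p_0 + p_1)^N >= (1 + 1/N)^N p_0^N >= 9/4 p_0^N, which forces v <= 6. *)
Require Import Defs.
From mathcomp Require Import all_boot all_order all_algebra finmap.
From mathcomp Require Import all_classical all_reals all_analysis.
From mathcomp Require Import ring lra zify.

Import Order.TTheory GRing.Theory Num.Theory.

Local Open Scope ring_scope.

(** * Winning bids *)

(** The index is shifted by one so that positivity holds by computation: [mkbid 0] is the bid 1 and
    [mkbid 1] the bid 2. *)
Definition mkbid (k : nat) : bid := exist _ k.+1 isT.

Lemma bidE (b : bid) : b = mkbid (val b).-1.
Proof. by apply: val_inj; case: b => -[]. Qed.

Definition seg (k : nat) : pure_strategy := [fset mkbid j | j in iota 0 k]%fset.

Lemma mem_seg k (b : bid) : (b \in seg k) = (val b <= k)%N.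
Proof.
apply/imfsetP/idP => [[j /= jk ->] /=|bk].
  by move: jk; rewrite mem_iota.
by exists (val b).-1; [case: b bk => -[|m] //= ? ?; rewrite mem_iota|exact: bidE].
Qed.

Lemma card_seg k : #|` seg k| = k.
Proof.
rewrite card_imfset /=; last by move=> x y [].
by rewrite undup_id ?size_iota ?iota_uniq.
Qed.

Lemma seg0 : seg 0 = fset0.
Proof. by apply/fsetP => b; rewrite mem_seg inE; case: b => -[]. Qed.

Lemma seg_inj : injective seg.
Proof. by move=> j k /(congr1 (fun s => #|` s|)); rewrite !card_seg. Qed.

Section Gain.
Context {R : realType} {n : nat}.
Implicit Types (S X : profile n) (i j : 'I_n) (b : bid) (s : pure_strategy).

Definition gain (v : R) i S : R :=
  if winning_bid S is Some b then
    if b \in S i then v - (val b)%:R else 0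
  else 0.

Lemma payoffE v c i S : payoff v c i S = gain v i S - c * #|` S i|%:R.
Proof.
rewrite /payoff /gain; case: winning_bid => [b|]; last by rewrite sub0r.
by case: ifP => _; rewrite ?sub0r //; ring.
Qed.

Definition sole S b : bool := #|[pred j | b \in S j]| == 1%N.

Lemma in_unique_bids S b : (b \in unique_bids S) = sole S b.
Proof.
rewrite /unique_bids !inE /= andb_idl // => /card1P /= [j /(_ j)].
rewrite !inE eqxx => bj; apply/bigfcupP; exists j => //.
by rewrite mem_enum.
Qed.

(** A form of winning free of [pick] and of the finite set of unique bids; gains are computed from
    it through [gainP]. *)
Definition wins S i b : Prop :=
  [/\ b \in S i, sole S b & forall b', (val b' < val b)%N -> ~~ sole S b'].

Lemma gainP v i S :
  (exists2 b, wins S i b & gain v i S = v - (val b)%:R)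
  \/ ((forall b, ~ wins S i b) /\ gain v i S = 0).
Proof.
rewrite /gain /winning_bid; case: pickP => [u /forallP /= umin|nomin] /=.
  have us : sole S (val u) by rewrite -in_unique_bids (valP u).
  case: ifP => [ui|/negP ui].
    left; exists (val u) => //; split=> // b' lt.
    apply/negP; rewrite -in_unique_bids => b'S.
    by have := umin [` b'S]%fset; rewrite /= leqNgt lt.
  right; split => // b [bi bs bmin]; apply: ui.
  have ub : (val (val u) <= val b)%N.
    have bS : b \in unique_bids S by rewrite in_unique_bids.
    exact: (umin [` bS]%fset).
  have bu : (val b <= val (val u))%N.
    by rewrite leqNgt; apply/negP => /bmin; rewrite us.
  suff -> : val u = b by [].
  by apply: val_inj; apply/eqP; rewrite eqn_leq ub.
right; split => // b [bi bs bmin].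
have bS : b \in unique_bids S by rewrite in_unique_bids.
have /negP[] := negbT (nomin [` bS]%fset); apply/forallP => t /=.
rewrite leqNgt; apply/negP => /bmin; rewrite -in_unique_bids.
by rewrite (valP t).
Qed.

Lemma wins_unique S i b b' : wins S i b -> wins S i b' -> b = b'.
Proof.
move=> [_ bs bm] [_ bs' bm']; apply: val_inj.
case: (ltngtP (val b) (val b')) => // [/bm'|/bm]; first by rewrite bs.
by rewrite bs'.
Qed.

Lemma gain_wins v i S b : wins S i b -> gain v i S = v - (val b)%:R.
Proof.
move=> w; have [[b' w' ->]|[/(_ b) //]] := gainP v i S.
by rewrite (wins_unique _ _ _ _ w w').
Qed.

Lemma gain_eq v i S S' : (forall b, wins S i b <-> wins S' i b) ->
  gain v i S = gain v i S'.
Proof.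
move=> SS'; have [[b /SS' w ->]|[nw ->]] := gainP v i S.
  by rewrite (gain_wins _ _ _ _ w).
by have [[b /SS' /nw]|[_ ->]] := gainP v i S'.
Qed.

Lemma gain_ge0 v i S : (forall b, b \in S i -> (val b)%:R <= v) ->
  0 <= gain v i S.
Proof.
move=> Sv; have [[b [bi _ _] ->]|[_ ->//]] := gainP v i S.
by rewrite subr_ge0 Sv.
Qed.

(** A crude bound on every bid of [s]: once the own set is fixed, it bounds the gain uniformly in
    the opponents' bids. *)
Definition bid_total s : R := (\sum_(b <- s) val b)%:R.

Lemma le_bid_total s b : b \in s -> (val b)%:R <= bid_total s.
Proof.
by move=> bs; rewrite ler_nat (big_rem b) //= leq_addr.
Qed.

Lemma gain_bound v i S : 0 <= v -> `|gain v i S| <= v + bid_total (S i).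
Proof.
move=> v0; have t0 : 0 <= bid_total (S i) by exact: ler0n.
have [[b [bi _ _] ->]|[_ ->]] := gainP v i S; last by rewrite normr0 addr_ge0.
have := le_bid_total _ _ bi; have : 0 <= (val b)%:R :> R by exact: ler0n.
by move=> *; rewrite ler_norml; apply/andP; split; lra.
Qed.

Definition setat X i s : profile n := [ffun j => if j == i then s else X j].

Lemma setat_same X i s : setat X i s i = s.
Proof. by rewrite ffunE eqxx. Qed.

Lemma setat_diff X i s j : j != i -> setat X i s j = X j.
Proof. by rewrite ffunE => /negbTE ->. Qed.

Lemma sole_setat_in X i s b : b \in s ->
  reflect (forall j, j != i -> b \notin X j) (sole (setat X i s) b).
Proof.
move=> bs; apply: (iffP card1P) => /= [[k kP] j ji|noj].
  apply/negP => bj; have := kP j; have := kP i.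
  rewrite !inE setat_same bs setat_diff // bj => /esym/eqP ik /esym/eqP jk.
  by move: ji; rewrite jk ik eqxx.
exists i => j; rewrite !inE; have [->|ji] := eqVneq j i.
  by rewrite setat_same.
by rewrite setat_diff //; exact/negbTE/noj.
Qed.

Lemma sole_setat_notin X i s b : X i = fset0 -> b \notin s ->
  sole (setat X i s) b = sole X b.
Proof.
move=> Xi bs; congr (_ == 1%N); apply: eq_card => j; rewrite !inE.
have [->|ji] := eqVneq j i; last by rewrite setat_diff.
by rewrite setat_same Xi (negbTE bs) inE.
Qed.

End Gain.

(** * Gains against opponents who bid initial segments *)

Section MonotoneOpponents.
Context {R : realType} {n : nat}.
Implicit Types (X : profile n) (i j : 'I_n) (b : bid) (v : R).

Definition nobody : profile n := [ffun=> fset0].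

Lemma nobodyP X i : X i = fset0 -> (forall j, j != i -> mkbid 0 \notin X j) ->
  (forall j, j != i -> exists k, X j = seg k) -> X = nobody.
Proof.
move=> Xi no1 Xseg; apply/ffunP => j; rewrite ffunE.
have [->//|ji] := eqVneq j i; have [k Xk] := Xseg j ji.
have := no1 j ji; rewrite Xk mem_seg -ltnNge ltnS leqn0 => /eqP ->.
exact: seg0.
Qed.

(* The bid k+1 never wins here: if some opponent bids k, then he also bids k+1;
   otherwise k is already unique (and if k = 0, somebody else bids 1). *)
Lemma gain_segS v i X k : (1 < n)%N ->
  (forall j, j != i -> exists2 l, X j = seg l & l != k) ->
  gain v i (setat X i (seg k.+1)) = gain v i (setat X i (seg k)).
Proof.
move=> n1 Xseg.
have sole_eq b : val b != k.+1 ->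
    sole (setat X i (seg k.+1)) b = sole (setat X i (seg k)) b.
  move=> bk; congr (_ == 1%N); apply: eq_card => j; rewrite !inE !ffunE.
  case: eqP => // _; rewrite !mem_seg; lia.
have top b : wins (setat X i (seg k.+1)) i b -> (val b <= k)%N.
  move=> [bi bs bmin]; move: (bi); rewrite setat_same mem_seg leq_eqVlt ltnS.
  case/orP => [/eqP bk|//]; exfalso.
  have lt_k j : j != i -> exists2 l, X j = seg l & (l < k)%N.
    move=> ji; have [l Xl lk] := Xseg j ji; exists l => //.
    have bS : b \in seg k.+1 by rewrite mem_seg bk.
    by have := sole_setat_in _ _ _ _ bS bs j ji; rewrite Xl mem_seg bk; lia.
  case: k => [|k] in Xseg sole_eq bi bs bmin bk lt_k *.
    have [j ji] : exists j, j != i.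
      have : (0 < #|predC1 i|)%N by rewrite cardC1 card_ord; lia.
      by case/card_gt0P => j; exists j.
    by have [] := lt_k j ji.
  suff /negP[] : ~~ sole (setat X i (seg k.+2)) (mkbid k).
    apply/sole_setat_in; first by rewrite mem_seg /=; lia.
    by move=> j ji; have [l -> lk] := lt_k j ji; rewrite mem_seg /=; lia.
  by apply: bmin; rewrite bk.
apply: gain_eq => b; split=> w.
  have bk := top b w; case: w => bi bs bmin; split.
  - by rewrite setat_same mem_seg.
  - by rewrite -sole_eq //; lia.
  - by move=> b' b'b; rewrite -sole_eq ?bmin //; lia.
case: w => bi bs bmin; have bk : (val b <= k)%N.
  by move: bi; rewrite setat_same mem_seg.
split.
- by rewrite setat_same mem_seg; lia.
- by rewrite sole_eq //; lia.
- by move=> b' b'b; rewrite sole_eq ?bmin //; lia.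
Qed.

Lemma gain_seg1_nobody v i : gain v i (setat nobody i (seg 1)) = v - 1.
Proof.
rewrite (@gain_wins _ _ _ _ _ (mkbid 0)) //; split.
- by rewrite setat_same mem_seg.
- by apply/sole_setat_in => [|j _]; rewrite ?mem_seg // ffunE inE.
- by move=> [[|b']].
Qed.

(** A nonempty segment contains 1, so the bid 1 is unique only if every opponent stays out. *)
Lemma gain_seg1 v i X : X i = fset0 ->
  (forall j, j != i -> exists k, X j = seg k) ->
  gain v i (setat X i (seg 1)) = (v - 1) * (X == nobody)%:R.
Proof.
move=> Xi Xseg; have [->|Xn] := eqVneq X nobody.
  by rewrite gain_seg1_nobody mulr1.
rewrite mulr0; have [[b [bi bs _] _]|[_ ->//]] := gainP v i (setat X i (seg 1)).
move: Xn => /eqP []; apply: (nobodyP _ i) => // j ji.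
move: bi; rewrite setat_same => bi.
have <- : b = mkbid 0.
  by apply: val_inj => /=; move: bi; rewrite mem_seg; case: (b) => -[|[]].
exact: (sole_setat_in _ _ _ _ bi bs).
Qed.

(** No opponent bids 2, so 2 is unique. It wins as soon as some opponent plays {1}, which blocks the
    bid 1; otherwise 1 wins, for one more unit. *)
Lemma gain_seg2_ge v i X :
  (forall j, j != i -> X j = fset0 \/ X j = seg 1) -> X i = fset0 ->
  v - 2 + (X == nobody)%:R <= gain v i (setat X i (seg 2)).
Proof.
move=> X01 Xi; have [->|Xn] := eqVneq X nobody.
  rewrite (@gain_wins _ _ _ _ _ (mkbid 0)) /=; first by lra.
  split; first by rewrite setat_same mem_seg.
    by apply/sole_setat_in => [|j _]; rewrite ?mem_seg // ffunE inE.
  by move=> [[|b']].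
rewrite (@gain_wins _ _ _ _ _ (mkbid 1)) /=; first by lra.
split; first by rewrite setat_same mem_seg.
  apply/sole_setat_in => [|j ji]; rewrite ?mem_seg //.
  by have [->|->] := X01 j ji; rewrite ?mem_seg ?inE.
move=> b' b'1; apply/negP => b's; move: Xn => /eqP[]; apply: (nobodyP _ i) => //.
  have -> : mkbid 0 = b' by apply: val_inj => /=; case: b' b'1 {b's} => -[|[]].
  by apply/(sole_setat_in X i (seg 2)) => //; rewrite mem_seg ltnW.
by move=> j ji; have [->|->] := X01 j ji; [exists 0%N; rewrite seg0|exists 1%N].
Qed.

(* Dropping the bid 1 from {1, 2} only hurts when nobody else participates or
   when exactly one opponent plays {1}. *)
Lemma gain_seg2_le v i X : 2 <= v -> X i = fset0 ->
  (forall j, j != i -> exists k, X j = seg k) ->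
  gain v i (setat X i (seg 2)) <= gain v i (setat X i [fset mkbid 1]%fset)
    + (X == nobody)%:R
    + (v - 2) * \sum_(j < n | j != i) (X == setat nobody j (seg 1))%:R.
Proof.
move=> v2 Xi Xseg.
have g2_ge0 : 0 <= gain v i (setat X i [fset mkbid 1]%fset).
  by apply: gain_ge0 => b; rewrite setat_same inE => /eqP ->.
set only_one := \sum_(j < n | _) _.
have v20 : 0 <= v - 2 by rewrite subr_ge0.
have one_ge0 : 0 <= (v - 2) * only_one.
  by rewrite mulr_ge0 // sumr_ge0 // => j _; exact: ler0n.
have nb_ge0 : 0 <= (X == nobody)%:R :> R by exact: ler0n.
have [[b [bi bs bmin] ->]|[_ ->]] := gainP v i (setat X i (seg 2)); last first.
  by rewrite !addr_ge0.
move: bi; rewrite setat_same => bi.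
have opp_b := sole_setat_in _ _ _ _ bi bs.
(* With [i] no longer bidding 1, the opponents alone decide whether 1 is unique. If none of them
   bids 2, the lone bid 2 wins unless exactly one of them bids 1. *)
have wins2 : (forall j, j != i -> mkbid 1 \notin X j) ->
    ~~ sole X (mkbid 0) ->
    gain v i (setat X i [fset mkbid 1]%fset) = v - 2.
  move=> no2 n1; rewrite (@gain_wins _ _ _ _ _ (mkbid 1)) //; split.
  - by rewrite setat_same inE.
  - by apply/sole_setat_in => //; rewrite inE.
  - move=> b' b'1; have -> : b' = mkbid 0.
      by apply: val_inj => /=; case: b' b'1 => -[|[]].
    by rewrite sole_setat_notin // inE.
have [b1|b2] : val b = 1%N \/ val b = 2%N.
  by move: bi; rewrite mem_seg; case: (b) => -[|[|[]]] //=; auto.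
- have eqb : b = mkbid 0 by apply: val_inj.
  have Xn : X = nobody by apply: (nobodyP _ i) => //; rewrite -eqb.
  rewrite wins2.
  + by rewrite b1 Xn eqxx mulr1n; lra.
  + by move=> j _; rewrite Xn ffunE inE.
  + rewrite /sole eq_card0 // => j; by rewrite !inE Xn ffunE inE.
- have eqb : b = mkbid 1 by apply: val_inj.
  rewrite b2; case: (boolP (sole X (mkbid 0))) => [|n1]; last first.
    by rewrite wins2 -?eqb //; lra.
  (* Exactly one opponent [j] bids 1. Since 2 wins, [j] does not bid 2 and so plays {1}; the others
     have segments without 1, hence stay out. *)
  case/card1P => /= j jP.
  have jX : mkbid 0 \in X j by have := jP j; rewrite !inE eqxx.
  have ji : j != i by apply: contraTneq jX => ->; rewrite Xi inE.
  have Xj : X = setat nobody j (seg 1).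
    apply/ffunP => l; rewrite !ffunE; have [->|lj] := eqVneq l j.
      have [k Xk] := Xseg j ji; rewrite Xk; congr seg.
      have := opp_b j ji; rewrite eqb Xk mem_seg /=.
      by move: jX; rewrite Xk mem_seg /=; lia.
    have [->//|li] := eqVneq l i.
    have [k Xk] := Xseg l li; have := jP l; rewrite !inE Xk mem_seg (negbTE lj) /=.
    by case: k {Xk} => // _; exact: seg0.
  have : 1 <= only_one.
    rewrite /only_one (bigD1 j) //= {1}Xj eqxx lerDl.
    by apply: sumr_ge0 => l _; exact: ler0n.
  by move=> /(ler_wpM2l v20); lra.
Qed.

End MonotoneOpponents.

(** * Sums over profiles *)

Section EsumExtra.
Context {R : realType}.

Lemma esumZl (T : choiceType) (I : set T) (a : T -> \bar R) (r : R) : 0 <= r ->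
  (forall i, 0 <= a i)%E ->
  (\esum_(i in I) (r%:E * a i) = r%:E * \esum_(i in I) a i)%E.
Proof.
move=> r0 a0; rewrite /esum -ereal_supZl //; last first.
  by apply/set0P; exists 0%E, set0%classic; [exact: fsets_set0|rewrite fsbig_set0].
congr ereal_sup; rewrite image_comp; apply: eq_imagel => A [finA _] /=.
by rewrite ge0_mule_fsumr.
Qed.

Lemma esum_ge_term (T : choiceType) (I : set T) (a : T -> \bar R) t : I t ->
  (forall i, I i -> 0 <= a i)%E -> (a t <= \esum_(i in I) a i)%E.
Proof.
move=> It a0; apply: esum_ge; exists [set t]%classic.
  by split; [exact: finite_set1|move=> _ ->].
by rewrite fsbig_set1.
Qed.

Lemma esum_only (T : choiceType) (I : set T) (a : T -> \bar R) t : I t ->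
  (0 <= a t)%E -> (forall i, I i -> i <> t -> a i = 0)%E ->
  (\esum_(i in I) a i = a t)%E.
Proof.
move=> It at0 a0; rewrite -(esum_set1 at0) esum_mkcond [RHS]esum_mkcond.
apply: eq_esum => i _; case: ifPn => [|/negP]; rewrite inE => Ii.
  by case: ifPn => [//|/negP]; rewrite inE => /= it; exact: a0.
by case: ifPn => //; rewrite inE /= => it; case: Ii; rewrite it.
Qed.

Lemma sum_le_esum (T : choiceType) (J : finType) (P : pred J) (x : J -> T)
    (I : set T) (a : T -> \bar R) : injective x -> (forall j, P j -> I (x j)) ->
  (\sum_(j | P j) a (x j) <= \esum_(i in I) a i)%E.
Proof.
move=> xinj xI; apply: esum_ge; exists (x @` [set j | P j])%classic.
  by split; [exact/finite_image|move=> _ [j /xI ? <-]].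
rewrite fsbig_image; last exact: in2W.
by rewrite -(bigfs _ (index_enum_uniq J)) // => j _; rewrite mem_index_enum.
Qed.

End EsumExtra.

(** * Expectations over the opponents' bids *)

Section OpponentExpectation.
Context {R : realType} {n : nat}.
Implicit Types (X S : profile n) (i j : 'I_n) (s t : pure_strategy).
Implicit Types (sigma : 'I_n -> mixed_strategy R) (tau : mixed_strategy R).
Implicit Types (f g : profile n -> R).

(* Profiles of the opponents of i are encoded as profiles where i does not
   participate. *)
Definition opp_profile i : set (profile n) := [set X | X i = fset0]%classic.

(** Emptying the set of [i] while remembering it is a bijection, which turns the sum into an
    iterated one. *)
Lemma esum_setat i (F : profile n -> \bar R) : (forall S, 0 <= F S)%E ->
  (\esum_(S in [set: profile n]%classic) F S =
   \esum_(s in [set: pure_strategy]%classic)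
     \esum_(X in opp_profile i) F (setat X i s))%E.
Proof.
move=> F0; rewrite esum_esum //.
apply: (reindex_esum _ _ (fun k => setat k.2 i k.1)); split.
- by [].
- move=> [s X] [t Y]; rewrite !inE => -[_ /= Xi] [_ /= Yi] e.
  have := congr1 (fun S : profile n => S i) e; rewrite /= !setat_same => ->.
  congr pair; apply/ffunP => j; have [->|ji] := eqVneq j i; first by rewrite Xi.
  by have := congr1 (fun S : profile n => S j) e; rewrite /= !setat_diff.
- move=> S _; exists (S i, setat S i fset0); first by split=> //=; exact: setat_same.
  apply/ffunP => j /=; have [->|ji] := eqVneq j i; first by rewrite setat_same.
  by rewrite !setat_diff.
Qed.

Definition opp_weight sigma i X : R := \prod_(j < n | j != i) sigma j (X j).

Lemma opp_weight_ge0 sigma i X : 0 <= opp_weight sigma i X.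
Proof. by apply: prodr_ge0 => j _; exact: prob_ge0. Qed.

(** For nonnegative [f] this is the expectation over the opponents' play. [esum] has no such meaning
    for signed families, so a gain that may be negative is first shifted by a constant. *)
Definition opp_esum sigma i f : \bar R :=
  (\esum_(X in opp_profile i) (opp_weight sigma i X * f X)%:E)%E.

Lemma profile_prob_ge0 sigma S : 0 <= profile_prob sigma S.
Proof. by apply: prodr_ge0 => j _; exact: prob_ge0. Qed.

Lemma profile_prob_deviate sigma i tau X s :
  profile_prob (deviate sigma i tau) (setat X i s) = tau s * opp_weight sigma i X.
Proof.
rewrite /profile_prob (bigD1 i) //= /deviate eqxx setat_same; congr (_ * _).
by apply: eq_bigr => j ji; rewrite (negbTE ji) setat_diff.
Qed.

Lemma opp_esum_ge0 sigma i f : (forall X, 0 <= f X) -> (0 <= opp_esum sigma i f)%E.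
Proof.
by move=> f0; apply: esum_ge0 => X _; rewrite lee_fin mulr_ge0 ?opp_weight_ge0.
Qed.

Lemma esum_deviate sigma i tau f : (forall S, 0 <= f S) ->
  (\esum_(S in [set: profile n]%classic)
     (profile_prob (deviate sigma i tau) S * f S)%:E =
   \esum_(s in [set: pure_strategy]%classic)
     ((tau s)%:E * opp_esum sigma i (fun X => f (setat X i s))))%E.
Proof.
move=> f0; rewrite (esum_setat i); last first.
  by move=> S; rewrite lee_fin mulr_ge0 ?profile_prob_ge0.
apply: eq_esum => s _; rewrite -esumZl ?prob_ge0 //; last first.
  by move=> X; rewrite lee_fin mulr_ge0 ?opp_weight_ge0.
by apply: eq_esum => X _; rewrite profile_prob_deviate -EFinM mulrA.
Qed.

Definition dirac_prob s t : R := (t == s)%:R.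

Lemma dirac_prob_ge0 s t : 0 <= dirac_prob s t. Proof. exact: ler0n. Qed.

Lemma dirac_prob_sum1 s :
  (\esum_(t in [set: pure_strategy]%classic) (dirac_prob s t)%:E = 1)%E.
Proof.
rewrite (esum_only _ _ _ s) ?lee_fin ?dirac_prob_ge0 // /dirac_prob ?eqxx //.
by move=> t _ /eqP/negbTE ->.
Qed.

Definition pure s : mixed_strategy R :=
  MixedStrategy (dirac_prob_ge0 s) (dirac_prob_sum1 s).

Lemma esum_pure s (g : pure_strategy -> \bar R) : (forall t, 0 <= g t)%E ->
  (\esum_(t in [set: pure_strategy]%classic) ((pure s t)%:E * g t) = g s)%E.
Proof.
move=> g0; rewrite (esum_only _ _ _ s) //= /dirac_prob ?eqxx ?mul1e //.
by move=> t _ /eqP/negbTE ->; rewrite mul0e.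
Qed.

Lemma deviate_self sigma i : deviate sigma i (sigma i) = sigma.
Proof. by apply/funext => j; rewrite /deviate; case: eqP => [->|]. Qed.

Lemma esum_prob_mulr tau (z : \bar R) : (0 <= z)%E ->
  (\esum_(s in [set: pure_strategy]%classic) ((tau s)%:E * z) = z)%E.
Proof.
case: z => [z z0||//].
- under eq_esum do rewrite muleC.
  rewrite esumZl //; last by move=> s; rewrite lee_fin prob_ge0.
  by rewrite prob_sum1 mule1.
(* Since [0 * +oo] is 0, the case [z = +oo] needs a set of positive probability, whose term alone is
   infinite. *)
- have [s taus] : exists s, tau s != 0.
    apply: contrapT => /forallNP tau0; have := @prob_sum1 _ tau.
    rewrite esum1 => [/eqP|s _]; first by rewrite lt_eqF ?lte01.
    by congr EFin; apply/eqP; rewrite -[_ == _]negbK; apply/negP/tau0.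
  move=> _; apply/eqP; rewrite -leye_eq.
  have {1}-> : +oo%E = ((tau s)%:E * +oo)%E :> \bar R.
    by rewrite gt0_muley // lte_fin lt0r taus prob_ge0.
  apply: (@esum_ge_term _ _ _ (fun s => (tau s)%:E * +oo)%E) => // t _.
  by rewrite mule_ge0 // lee_fin prob_ge0.
Qed.

Definition total_prob sigma : \bar R :=
  (\esum_(S in [set: profile n]%classic) (profile_prob sigma S)%:E)%E.

Lemma total_prob_deviate sigma i tau :
  total_prob (deviate sigma i tau) = opp_esum sigma i (fun=> 1).
Proof.
rewrite -[RHS](esum_prob_mulr tau) ?opp_esum_ge0 //.
rewrite -(esum_deviate _ _ _ (fun=> 1)) //.
by apply: eq_esum => S _; rewrite mulr1.
Qed.

Lemma total_prob_pure : total_prob (fun=> pure fset0) = 1%E.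
Proof.
rewrite /total_prob (esum_only _ _ _ nobody) ?lee_fin ?profile_prob_ge0 //.
  by congr EFin; apply: big1 => j _; rewrite /= /dirac_prob ffunE eqxx.
move=> S _ Sn; congr EFin; have [/existsP[j Sj]|/existsPn S0] :=
  boolP [exists j, S j != fset0].
  by rewrite /profile_prob (bigD1 j) //= /dirac_prob (negbTE Sj) mul0r.
by case: Sn; apply/ffunP => j; rewrite ffunE; apply/eqP; rewrite -[_ == _]negbK.
Qed.

(* The total mass does not depend on any single strategy, so all of them can be
   replaced one after the other by a point mass. *)
Lemma total_probE sigma : total_prob sigma = 1%E.
Proof.
pose sig (k : nat) (j : 'I_n) := if (j < k)%N then pure fset0 else sigma j.
have step k : (k <= n)%N -> total_prob (sig k) = total_prob sigma.
  elim: k => [_|k IH kn]; first by congr total_prob; apply/funext.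
  have -> : sig k.+1 = deviate (sig k) (Ordinal kn) (pure fset0).
    apply/funext => j; rewrite /deviate /sig ltnS leq_eqVlt -val_eqE /=.
    by case: eqP.
  rewrite total_prob_deviate -(total_prob_deviate _ _ (sig k (Ordinal kn))).
  by rewrite deviate_self IH // ltnW.
rewrite -(step n) // -total_prob_pure; congr total_prob; apply/funext => j.
by rewrite /sig ltn_ord.
Qed.

Lemma opp_esum1 sigma i : opp_esum sigma i (fun=> 1) = 1%E.
Proof. by rewrite -(total_prob_deviate _ _ (sigma i)) total_probE. Qed.

(** Profiles of weight zero contribute nothing, so the comparison may assume that each opponent
    plays within the support of his strategy. *)
Lemma le_opp_esum sigma i f g :
  (forall X, X i = fset0 -> opp_weight sigma i X != 0 -> f X <= g X) ->
  (opp_esum sigma i f <= opp_esum sigma i g)%E.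
Proof.
move=> fg; apply: le_esum => X Xi; rewrite lee_fin.
have [->|w0] := eqVneq (opp_weight sigma i X) 0; first by rewrite !mul0r.
by rewrite ler_wpM2l ?opp_weight_ge0 ?fg.
Qed.

Lemma eq_opp_esum sigma i f g :
  (forall X, X i = fset0 -> opp_weight sigma i X != 0 -> f X = g X) ->
  opp_esum sigma i f = opp_esum sigma i g.
Proof.
by move=> fg; apply/eqP; rewrite eq_le !le_opp_esum // => X Xi w; rewrite fg.
Qed.

Lemma opp_esumD sigma i f g : (forall X, 0 <= f X) -> (forall X, 0 <= g X) ->
  (opp_esum sigma i (fun X => f X + g X)%R = opp_esum sigma i f + opp_esum sigma i g)%E.
Proof.
move=> f0 g0; rewrite -esumD => [|X _|X _]; last 2 first.
- by rewrite lee_fin mulr_ge0 ?opp_weight_ge0.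
- by rewrite lee_fin mulr_ge0 ?opp_weight_ge0.
by apply: eq_esum => X _; rewrite -EFinD mulrDr.
Qed.

Lemma opp_esumZ sigma i f (r : R) : 0 <= r -> (forall X, 0 <= f X) ->
  (opp_esum sigma i (fun X => r * f X)%R = r%:E * opp_esum sigma i f)%E.
Proof.
move=> r0 f0; rewrite -esumZl // => [|X]; last first.
  by rewrite lee_fin mulr_ge0 ?opp_weight_ge0.
by apply: eq_esum => X _; rewrite -EFinM mulrCA.
Qed.

Lemma opp_esum_sum sigma i (P : pred 'I_n) (f : 'I_n -> profile n -> R) :
  (forall j X, 0 <= f j X) ->
  (opp_esum sigma i (fun X => \sum_(j | P j) f j X)%R =
   \sum_(j | P j) opp_esum sigma i (f j))%E.
Proof.
move=> f0; rewrite /opp_esum -esum_sum => [|X j _ _]; last first.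
  by rewrite lee_fin mulr_ge0 ?opp_weight_ge0.
by apply: eq_esum => X _; rewrite mulr_sumr sumEFin.
Qed.

Lemma opp_esum_cst sigma i (r : R) : 0 <= r -> opp_esum sigma i (fun=> r) = r%:E.
Proof.
move=> r0; have := opp_esumZ sigma i (fun=> 1) r r0 (fun=> ler01).
by rewrite opp_esum1 mule1 => <-; apply: eq_opp_esum => X _ _; rewrite mulr1.
Qed.

Lemma opp_esum_point sigma i (Y : profile n) : Y i = fset0 ->
  opp_esum sigma i (fun X => (X == Y)%:R) = (opp_weight sigma i Y)%:E.
Proof.
move=> Yi; rewrite /opp_esum (esum_only _ _ _ Y) ?eqxx ?mulr1 //.
  by rewrite lee_fin opp_weight_ge0.
by move=> X _ /eqP/negbTE ->; rewrite mulr0.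
Qed.

Lemma opp_esum_fin sigma i f (B : R) : (forall X, 0 <= f X <= B) ->
  opp_esum sigma i f = (fine (opp_esum sigma i f))%:E.
Proof.
move=> fB; have B0 : 0 <= B by have /andP[/le_trans] := fB nobody; apply.
have f0 X : 0 <= f X by case/andP: (fB X).
rewrite fineK // ge0_fin_numE ?opp_esum_ge0 //.
apply: (@le_lt_trans _ _ B%:E); last exact: ltry.
by rewrite -(opp_esum_cst sigma i B) // le_opp_esum // => X _ _; case/andP: (fB X).
Qed.

End OpponentExpectation.

(** * Pure deviations from an equilibrium *)

Section PureDeviations.
Context {R : realType} {n : nat} (v c : R) (sigma : 'I_n -> mixed_strategy R).
Context (v_ge0 : 0 <= v) (c_ge0 : 0 <= c).
Implicit Types (X S : profile n) (i : 'I_n) (s : pure_strategy).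

Let pay i s X := payoff v c i (setat X i s).
Let pos i s X := Num.max (pay i s X) 0.
Let neg i s X := Num.max (- pay i s X) 0.

Let pay_bound i s X : `|pay i s X| <= v + bid_total s + c * #|` s|%:R.
Proof.
rewrite /pay payoffE setat_same (le_trans (ler_normB _ _)) // lerD //.
  by have := gain_bound v i (setat X i s) v_ge0; rewrite setat_same.
by rewrite ger0_norm // mulr_ge0.
Qed.

Let pos_bound i s X : 0 <= pos i s X <= v + bid_total s + c * #|` s|%:R.
Proof.
have := pay_bound i s X; rewrite ler_norml => /andP[lo hi].
rewrite le_max lexx orbT ge_max hi; apply/andP; split=> //; lra.
Qed.

Let neg_bound i s X : 0 <= neg i s X <= v + bid_total s + c * #|` s|%:R.
Proof.
have := pay_bound i s X; rewrite ler_norml => /andP[lo hi].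
rewrite le_max lexx orbT ge_max; apply/andP; split=> //; lra.
Qed.

Let pos_ge0 i s X : 0 <= pos i s X. Proof. by case/andP: (pos_bound i s X). Qed.
Let neg_ge0 i s X : 0 <= neg i s X. Proof. by case/andP: (neg_bound i s X). Qed.

(** The expected payoff of playing [s] for sure against [sigma]. Payoffs are bounded for fixed [s],
    so [fine] discards nothing. *)
Definition pure_value i s : R :=
  fine (opp_esum sigma i (pos i s)) - fine (opp_esum sigma i (neg i s)).

Let opp_pos i s : opp_esum sigma i (pos i s) =
  (fine (opp_esum sigma i (pos i s)))%:E.
Proof. exact: opp_esum_fin (pos_bound i s). Qed.

Let opp_neg i s : opp_esum sigma i (neg i s) =
  (fine (opp_esum sigma i (neg i s)))%:E.
Proof. exact: opp_esum_fin (neg_bound i s). Qed.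

(** The gain is the payoff plus the cost of the bids, averaged over the opponents. Bids above [v]
    may win at a loss; [L] makes up for that. *)
Lemma opp_esum_gain i s (L : R) : 0 <= L ->
  (forall X, 0 <= gain v i (setat X i s) + L) ->
  opp_esum sigma i (fun X => gain v i (setat X i s) + L) =
  (pure_value i s + c * #|` s|%:R + L)%:E.
Proof.
move=> L0 gL; set g := fun X => _; set C := c * #|` s|%:R + L.
have C0 : 0 <= C by rewrite addr_ge0 // mulr_ge0.
have gfin : opp_esum sigma i g = (fine (opp_esum sigma i g))%:E.
  apply: (@opp_esum_fin _ _ _ _ _ (v + bid_total s + L)) => X; rewrite gL /= lerD2r.
  apply: (le_trans (ler_norm _)).
  by have := gain_bound v i (setat X i s) v_ge0; rewrite setat_same.
(* Adding the negative part on one side instead of subtracting it on the other keeps every summand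
   nonnegative. *)
have : (opp_esum sigma i (pos i s) + opp_esum sigma i (fun=> C) =
        opp_esum sigma i (neg i s) + opp_esum sigma i g)%E.
  rewrite -!opp_esumD //; apply: eq_opp_esum => X _ _.
  rewrite /g /C /pos /neg; have -> : gain v i (setat X i s) =
    pay i s X + c * #|` s|%:R by rewrite /pay payoffE setat_same; ring.
  rewrite !/Num.max; case: ifP => p; case: ifP => q; lra.
rewrite opp_esum_cst // opp_pos opp_neg gfin -!EFinD => -[e].
by congr EFin; rewrite /pure_value; move: e; rewrite /C; lra.
Qed.

Lemma pure_value_fset0 i : pure_value i fset0 = 0.
Proof.
have g0 X : gain v i (setat X i fset0) = 0.
  have [[b [+ _ _] _]|[_ ->//]] := gainP v i (setat X i fset0).
  by rewrite setat_same inE.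
have g0' X : 0 <= gain v i (setat X i fset0) + 0 by rewrite g0 addr0.
have := opp_esum_gain i fset0 0 (lexx _) g0'.
rewrite cardfs0 mulr0 !addr0 (@eq_opp_esum _ _ _ _ _ (fun=> 0)); last first.
  by move=> X _ _; rewrite g0 addr0.
by rewrite opp_esum_cst // => -[].
Qed.

Lemma expected_payoff_deviate i tau :
  expected_payoff v c (deviate sigma i tau) i =
  (\esum_(s in [set: pure_strategy]%classic)
     ((tau s)%:E * opp_esum sigma i (pos i s))
   - \esum_(s in [set: pure_strategy]%classic)
     ((tau s)%:E * opp_esum sigma i (neg i s)))%E.
Proof.
rewrite /expected_payoff -(esum_deviate _ _ _ (fun S => Num.max (payoff v c i S) 0)).
  by rewrite -(esum_deviate _ _ _ (fun S => Num.max (- payoff v c i S) 0)) // => S;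
    rewrite le_max lexx orbT.
by move=> S; rewrite le_max lexx orbT.
Qed.

Lemma expected_payoff_pure i s :
  expected_payoff v c (deviate sigma i (pure s)) i = (pure_value i s)%:E.
Proof.
rewrite expected_payoff_deviate esum_pure => [|t]; last exact: opp_esum_ge0.
rewrite esum_pure => [|t]; last exact: opp_esum_ge0.
by rewrite opp_pos opp_neg -EFinB.
Qed.

(** The equilibrium payoff averages the pure values, and none of them exceeds it because pure
    deviations do not pay; hence every set in the support attains it. *)
Lemma nash_pure_value i : nash_equilibrium v c sigma ->
  exists e : R, forall s, pure_value i s <= e /\ (sigma i s != 0 -> pure_value i s = e).
Proof.
move=> nash.
pose P := (\esum_(s in [set: pure_strategy]%classic)
  ((sigma i s)%:E * opp_esum sigma i (pos i s)))%E.
pose N := (\esum_(s in [set: pure_strategy]%classic)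
  ((sigma i s)%:E * opp_esum sigma i (neg i s)))%E.
have le_dev s : ((pure_value i s)%:E <= P - N)%E.
  rewrite -expected_payoff_pure (le_trans (nash i (pure s))) //.
  by rewrite -{1}(deviate_self sigma i) expected_payoff_deviate.
have Pfin : P \is a fin_num.
  rewrite ge0_fin_numE; last first.
    by apply: esum_ge0 => s _; rewrite mule_ge0 ?lee_fin ?prob_ge0 ?opp_esum_ge0.
  apply: (@le_lt_trans _ _ v%:E); last exact: ltry.
  rewrite -(esum_prob_mulr (sigma i) v%:E) //.
  apply: le_esum => s _; apply: lee_wpmul2l; first by rewrite lee_fin prob_ge0.
  rewrite -(opp_esum_cst sigma i v v_ge0); apply: le_opp_esum => X _ _.
  rewrite ge_max v_ge0 andbT /pay payoffE setat_same.
  have cs0 : 0 <= c * #|` s|%:R by rewrite mulr_ge0.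
  have [[b _ ->]|[_ ->]] := gainP v i (setat X i s).
    by have b0 : 0 <= (val b)%:R :> R by []; lra.
  by rewrite sub0r (le_trans _ v_ge0) // oppr_le0.
(* An infinite negative part would make the payoff -oo, whereas staying out secures 0. *)
have Nfin : N \is a fin_num.
  have N0 : (0 <= N)%E.
    by apply: esum_ge0 => s _; rewrite mule_ge0 ?lee_fin ?prob_ge0 ?opp_esum_ge0.
  rewrite ge0_fin_numE // ltey; apply/eqP => Noo.
  have := le_dev fset0; rewrite Noo pure_value_fset0 -(fineK Pfin) /=.
  by rewrite leeNy_eq.
exists (fine P - fine N) => s0; set e := fine P - fine N.
have le_e s : pure_value i s <= e.
  by have := le_dev s; rewrite -(fineK Pfin) -(fineK Nfin) -EFinB lee_fin.
split=> // sig0.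
have e0 : 0 <= e by rewrite -(pure_value_fset0 i).
(* The weighted shortfall of [s] from [e]. These nonnegative terms sum to 0, so each of them
   vanishes. *)
pose gap s := ((sigma i s)%:E * (e - pure_value i s)%:E)%E.
have gap0 s : (0 <= gap s)%E.
  by rewrite mule_ge0 ?lee_fin ?prob_ge0 // subr_ge0.
have : (P + \esum_(s in [set: pure_strategy]%classic) gap s = N + e%:E)%E.
  rewrite -(esum_prob_mulr (sigma i) e%:E) // -!esumD //.
  - apply: eq_esum => s _; rewrite /gap /pure_value opp_pos opp_neg -!EFinM -!EFinD.
    by congr EFin; rewrite /=; ring.
  - by move=> s _; rewrite mule_ge0 ?lee_fin ?prob_ge0 ?opp_esum_ge0.
  - by move=> s _; rewrite mule_ge0 ?lee_fin ?prob_ge0.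
  - by move=> s _; rewrite mule_ge0 ?lee_fin ?prob_ge0 ?opp_esum_ge0.
have -> : (N + e%:E = P + 0)%E.
  by rewrite -(fineK Pfin) -(fineK Nfin) -!EFinD; congr EFin; rewrite /e /=; ring.
move=> /(congr1 (fun x => x - P)%E); rewrite ![(P + _)%E]addeC !addeK // => gap_sum.
have : (gap s0 <= 0)%E by rewrite -gap_sum esum_ge_term.
rewrite /gap -EFinM lee_fin pmulr_rle0; last by rewrite lt0r sig0 prob_ge0.
by have := le_e s0; lra.
Qed.

End PureDeviations.

(** * Symmetric monotone strategies *)

(** Binomial expansion cut after the square; the induction step loses only the cubic term m (m - 1)
    / 2 * x ^ 3. *)
Lemma expr1D_ge {R : realFieldType} (x : R) m : 0 <= x ->
  1 + m%:R * x + m%:R * (m%:R - 1) / 2 * x ^+ 2 <= (1 + x) ^+ m.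
Proof.
move=> x0; elim: m => [|m IH]; first by rewrite expr0; lra.
have [->|m1] := posnP m; first by rewrite expr1; lra.
rewrite [(1 + x) ^+ _]exprS; apply: (@le_trans _ _ ((1 + x) * (1 + m%:R * x
  + m%:R * (m%:R - 1) / 2 * x ^+ 2))); last first.
  by rewrite ler_wpM2l // addr_ge0.
rewrite -natr1; have m1' : 1 <= m%:R :> R by rewrite ler1n.
rewrite -subr_ge0 (_ : _ - _ = m%:R * (m%:R - 1) / 2 * x ^+ 3); last by field.
by rewrite !mulr_ge0 ?exprn_ge0 ?invr_ge0 ?subr_ge0 //; lra.
Qed.

(* With m opponents, [b >= a / m] gives [(a + b) ^ m >= (1 + 1 / m) ^ m * a ^ m]. *)
Lemma exprD_ge94 {R : realFieldType} (a b : R) m : (1 < m)%N -> 0 <= a ->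
  a <= m%:R * b -> 9 / 4 * a ^+ m <= (a + b) ^+ m.
Proof.
move=> m1 a0 ab; have m2 : 2 <= m%:R :> R by rewrite ler_nat.
have mn0 : m%:R != 0 :> R by rewrite pnatr_eq0 -lt0n ltnW.
have m0 : 0 < m%:R :> R by lra.
have b0 : 0 <= b by rewrite -(pmulr_rge0 _ m0) (le_trans a0).
have im0 : 0 <= (m%:R)^-1 :> R by rewrite invr_ge0.
apply: (@le_trans _ _ (((1 + m%:R^-1) * a) ^+ m)); last first.
  rewrite lerXn2r ?nnegrE ?mulr_ge0 ?addr_ge0 //.
  by rewrite mulrDl mul1r lerD2l mulrC ler_pdivrMr 1?mulrC.
rewrite exprMn ler_wpM2r ?exprn_ge0 //; apply: le_trans _ (expr1D_ge _ _ im0).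
(* At x = 1 / m the quadratic bound is 2 + (m - 1) / (2 m), which increases from 9/4 at m = 2. *)
rewrite -subr_ge0 (_ : _ - _ = (m%:R - 2) / (4 * m%:R)); last by field.
by rewrite divr_ge0 ?subr_ge0 // mulr_ge0 //; lra.
Qed.

Section SymmetricMonotone.
Context {R : realType} {n : nat} (sigma : mixed_strategy R).
Context (mono : monotone_strategy sigma).
Implicit Types (X : profile n) (i j : 'I_n).

Notation prof := (fun _ : 'I_n => sigma).

Lemma supp_seg S : sigma S != 0 -> exists2 k, S = seg k & sigma (seg k) != 0.
Proof.
move=> S0; have [k kP] := mono S S0; have Sk : S = seg k.
  by apply/fsetP => b; rewrite kP mem_seg.
by exists k; rewrite -?Sk.
Qed.

Lemma opp_weight_supp i X j : opp_weight prof i X != 0 -> j != i ->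
  exists2 k, X j = seg k & sigma (seg k) != 0.
Proof.
move=> w0 ji; apply: supp_seg; apply: contraNneq w0 => Xj.
by rewrite /opp_weight (bigD1 j) //= Xj mul0r.
Qed.

Lemma opp_weight_seg i X j : opp_weight prof i X != 0 -> j != i ->
  exists k, X j = seg k.
Proof. by move=> w0 /(opp_weight_supp _ _ _ w0)[k]; exists k. Qed.

Lemma prod_opp i (x : R) : \prod_(j < n | j != i) x = x ^+ n.-1.
Proof.
transitivity (\prod_(j in predC1 i) x); first by apply: eq_bigl.
by rewrite prodr_const cardC1 card_ord.
Qed.

Lemma opp_weight_nobody i : opp_weight prof i nobody = sigma (seg 0) ^+ n.-1.
Proof.
by rewrite -(prod_opp i); apply: eq_bigr => j _; rewrite ffunE seg0.
Qed.

(** The factor [sigma (seg 0)] stands for the abstention that [j] gave up; it completes the power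
    and avoids division and the exponent n - 2. *)
Lemma opp_weight_one i j s : j != i ->
  sigma (seg 0) * opp_weight prof i (setat nobody j s)
    = sigma s * sigma (seg 0) ^+ n.-1.
Proof.
move=> ji; rewrite -(opp_weight_nobody i) /opp_weight !(bigD1 j ji) /=.
rewrite setat_same ffunE -seg0 mulrCA; congr (_ * (_ * _)).
by apply: eq_bigr => l /andP[_ lj]; rewrite setat_diff.
Qed.

(** Distributing the power gives one term for each choice of {} or {1} by each opponent. Distinct
    choices are distinct profiles, so a finite part of the sum suffices. *)
Lemma opp_esum_atmost1 i :
  (((sigma (seg 0) + sigma (seg 1)) ^+ n.-1)%:E <= opp_esum prof i
    (fun X => [forall (j | j != i), X j \in [:: fset0; seg 1]]%:R))%E.
Proof.
pose x (f : {ffun 'I_n -> bool}) : profile n := [ffun j => seg (f j)].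
have xinj : injective x.
  move=> f g /ffunP fg; apply/ffunP => j; have := fg j; rewrite !ffunE.
  by move=> /seg_inj; case: (f j) (g j) => -[].
(* A boolean serves as the length of a segment; [P] keeps [f] false at [i], so that [i] stays out in
   [x f], as [opp_profile] requires. *)
pose P := pffun_on false (fun j => j != i) (fun _ : bool => true).
have xI f : P f -> opp_profile i (x f).
  move=> /pffun_onP [/fintype.subsetP fi _]; rewrite /opp_profile /= ffunE.
  case fi' : (f i); last exact: seg0.
  by have := fi i; rewrite inE fi' => /(_ isT); rewrite unfold_in eqxx.
apply: le_trans _ (sum_le_esum _ _ P x _ _ xinj xI).
have -> : sigma (seg 0) + sigma (seg 1) = \sum_(d : bool) sigma (seg d).
  by rewrite big_bool addrC.
rewrite sumEFin lee_fin -(prod_opp i).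
rewrite (big_distr_big false) /= le_eqVlt; apply/orP; left; apply/eqP.
apply: eq_bigr => f _; rewrite [X in nat_of_bool X](_ : _ = true) ?mulr1.
  by apply: eq_bigr => j _; rewrite ffunE.
by apply/forall_inP => j _; rewrite !inE ffunE; case: (f j); rewrite ?seg0 eqxx ?orbT.
Qed.

Lemma no_monotone_equilibrium (v c : R) : 10 < v -> 2 * c + 2 < v -> 0 < c ->
  (2 < n)%N -> ~ nash_equilibrium v c prof.
Proof.
move=> v_gt10 v_gt c_gt0 n_ge3 nash.
have v0 : 0 <= v by lra.
have c0 : 0 <= c by exact: ltW.
have n0 : (0 < n)%N by lia.
have n1 : (1 < n.-1)%N by lia.
pose i := Ordinal n0; pose U := pure_value v c prof i.
have [e eP] := nash_pure_value v c prof v0 c0 i nash.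
have Ule s : U s <= e by case: (eP s).
have Ueq s : sigma s != 0 -> U s = e by case: (eP s).
(* Otherwise [seg k] would have the expected gain of [seg k.+1] at a cost lower by [c], hence a
   value above [e]. *)
have down k : sigma (seg k.+1) != 0 -> sigma (seg k) != 0.
  move=> pk1; apply/negP => /eqP pk.
  (* As [k] is arbitrary, bids above [v] can win; [L] makes both shifted gains nonnegative. *)
  pose L := v + bid_total (seg k.+1) + bid_total (seg k) : R.
  have t0 s : 0 <= bid_total s :> R by exact: ler0n.
  have L0 : 0 <= L by rewrite !addr_ge0.
  have gL l X : l \in [:: k; k.+1] -> 0 <= gain v i (setat X i (seg l)) + L.
    move=> lk; have := gain_bound v i (setat X i (seg l)) v0.
    rewrite setat_same ler_norml => /andP[lo _].
    suff : bid_total (seg l) <= L - v by lra.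
    have := t0 (seg k); have := t0 (seg k.+1); rewrite /L.
    by move: lk; rewrite !inE => /orP[] /eqP ->; lra.
  have gLk X : 0 <= gain v i (setat X i (seg k)) + L by rewrite gL // !inE eqxx.
  have gLk1 X : 0 <= gain v i (setat X i (seg k.+1)) + L.
    by rewrite gL // !inE eqxx orbT.
  have := opp_esum_gain v c prof v0 c0 i (seg k.+1) L L0 gLk1.
  rewrite (@eq_opp_esum _ _ _ _ _ (fun X => gain v i (setat X i (seg k)) + L)).
    rewrite (opp_esum_gain v c prof v0 c0 i (seg k) L L0 gLk) => -[].
    rewrite !card_seg -natr1 -!/(U _) (Ueq _ pk1).
    by have := Ule (seg k); lra.
  move=> X Xi w; rewrite gain_segS //; first by lia.
  move=> j ji; have [l -> pl] := opp_weight_supp _ _ _ w ji; exists l => //.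
  by apply: contraNneq pl => ->; rewrite pk.
have supp_le k l : (l <= k)%N -> sigma (seg k) != 0 -> sigma (seg l) != 0.
  elim: k => [|k IH]; first by rewrite leqn0 => /eqP ->.
  by rewrite leq_eqVlt ltnS => /orP[/eqP->//|/IH lk /down].
have p0 : sigma (seg 0) != 0.
  have [S S0] : exists S, sigma S != 0.
    apply: contrapT => /forallNP sig0; have := @prob_sum1 _ sigma.
    rewrite esum1 => [/eqP|S _]; first by rewrite lt_eqF ?lte01.
    by congr EFin; apply/eqP; rewrite -[_ == _]negbK; apply/negP/sig0.
  by have [k _ pk] := supp_seg S S0; exact: (supp_le k).
have e_eq : e = 0 by rewrite -(Ueq _ p0) seg0 /U pure_value_fset0.
(* Bids up to 2 lie below [v], so these gains are nonnegative and the shift is 0. *)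
have gain_esum s : (forall b, b \in s -> (val b <= 2)%N) ->
    opp_esum prof i (fun X => gain v i (setat X i s)) = (U s + c * #|` s|%:R)%:E.
  move=> s2; have g0 X : 0 <= gain v i (setat X i s).
    apply: gain_ge0 => b; rewrite setat_same => /s2.
    by rewrite -(ler_nat R); lra.
  have g0' X : 0 <= gain v i (setat X i s) + 0 by rewrite addr0.
  have := opp_esum_gain v c prof v0 c0 i s 0 (lexx _) g0'.
  rewrite addr0 => <-; apply: eq_opp_esum => X _ _; by rewrite addr0.
have esum1 : opp_esum prof i (fun X => gain v i (setat X i (seg 1)))
    = (U (seg 1) + c)%:E.
  by rewrite gain_esum ?card_seg ?mulr1 // => b; rewrite mem_seg => /leq_trans; apply.
have esum2 : opp_esum prof i (fun X => gain v i (setat X i (seg 2)))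
    = (U (seg 2) + c * 2)%:E.
  by rewrite gain_esum ?card_seg // => b; rewrite mem_seg.
have esum_2 : opp_esum prof i (fun X => gain v i (setat X i [fset mkbid 1]%fset))
    = (U [fset mkbid 1]%fset + c)%:E.
  by rewrite gain_esum ?cardfs1 ?mulr1 // => b; rewrite inE => /eqP ->.
have U1le := Ule (seg 1); have U2le := Ule (seg 2).
have U_2le := Ule [fset mkbid 1]%fset.
(* If {1} had probability zero, no opponent would ever participate and {1} would win v - 1 > c for
   sure. *)
have p1 : sigma (seg 1) != 0.
  apply/negP => /eqP p1.
  suff : v - 1 <= U (seg 1) + c by lra.
  rewrite -lee_fin -esum1 -(opp_esum_cst prof i (v - 1)); last by lra.
  apply: le_opp_esum => X Xi w; rewrite gain_seg1 //; last first.
    by move=> j; exact: opp_weight_seg w.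
  suff -> : X = nobody by rewrite eqxx mulr1.
  apply/ffunP => j; rewrite ffunE; have [->//|ji] := eqVneq j i.
  have [[|k] -> pk] := opp_weight_supp _ _ _ w ji; first exact: seg0.
  by have := supp_le k.+1 1%N isT pk; rewrite p1 eqxx.
(* If {1, 2} had probability zero, opponents would play {} or {1}, and {1, 2} would gain at least v
   - 2 > 2c. *)
have p2 : sigma (seg 2) != 0.
  apply/negP => /eqP p2.
  suff : v - 2 <= U (seg 2) + c * 2 by lra.
  rewrite -lee_fin -esum2 -(opp_esum_cst prof i (v - 2)); last by lra.
  apply: le_opp_esum => X Xi w; apply: le_trans _ (gain_seg2_ge v i X _ Xi).
    by rewrite lerDl.
  move=> j ji; have [[|[|k]] -> pk] := opp_weight_supp _ _ _ w ji.
  - by left; exact: seg0.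
  - by right.
  - by have := supp_le k.+2 2%N isT pk; rewrite p2 eqxx.
set a := sigma (seg 0) in p0; set b := sigma (seg 1) in p1.
have a0 : 0 < a by rewrite lt0r p0 prob_ge0.
(* [A] is the probability that no opponent participates. *)
pose A := a ^+ n.-1; have A0 : 0 < A by exact: exprn_gt0.
have v10 : 0 <= v - 1 by lra.
have eqA : (v - 1) * A = c.
  have : (U (seg 1) + c)%:E = ((v - 1) * A)%:E.
    rewrite -esum1 (@eq_opp_esum _ _ _ _ _ (fun X => (v - 1) * (X == nobody)%:R)).
      by rewrite opp_esumZ // opp_esum_point ?ffunE // opp_weight_nobody EFinM.
    by move=> X Xi w; rewrite gain_seg1 // => j; exact: opp_weight_seg w.
  by rewrite (Ueq _ p1) e_eq => -[]; lra.
have v20 : 0 <= v - 2 by lra.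
have ab : a <= n.-1%:R * b.
  (* [w] is the probability that exactly one opponent plays {1} and the others stay out. *)
  pose w := \sum_(j < n | j != i) opp_weight prof i (setat nobody j (seg 1)).
  have : c * 2 <= U [fset mkbid 1]%fset + c + A + (v - 2) * w.
    rewrite -[c * 2]add0r -[X in X + _]e_eq -(Ueq _ p2) -lee_fin -esum2.
    pose one X : R := \sum_(j < n | j != i) (X == setat nobody j (seg 1))%:R.
    have one0 X : 0 <= one X by apply: sumr_ge0 => j _; exact: ler0n.
    apply: (@le_trans _ _ (opp_esum prof i (fun X =>
      gain v i (setat X i [fset mkbid 1]%fset) + (X == nobody)%:R
        + (v - 2) * one X))).
      apply: le_opp_esum => X Xi wX; apply: gain_seg2_le => //; first by lra.
      by move=> j; exact: opp_weight_seg wX.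
    have g0 X : 0 <= gain v i (setat X i [fset mkbid 1]%fset).
      by apply: gain_ge0 => d; rewrite setat_same inE => /eqP -> /=; lra.
    rewrite opp_esumD => [|X|X]; rewrite ?addr_ge0 ?mulr_ge0 //.
    rewrite opp_esumD // esum_2 opp_esumZ // opp_esum_point ?ffunE //.
    rewrite opp_weight_nobody opp_esum_sum //.
    rewrite (eq_bigr (fun j => (opp_weight prof i (setat nobody j (seg 1)))%:E)).
      by rewrite sumEFin -/a -/A -/w -EFinM -!EFinD.
    by move=> j ji; rewrite opp_esum_point // setat_diff 1?eq_sym // ffunE.
  have aw : a * w = n.-1%:R * (b * A).
    rewrite /w mulr_sumr (eq_bigr (fun=> b * A)); last first.
      by move=> j; exact: opp_weight_one.
    transitivity (\sum_(j in predC1 i) b * A); first exact: eq_bigl.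
    by rewrite sumr_const cardC1 card_ord mulr_natl.
  (* The lone bid 2 has value at most 0, so c <= A + (v - 2) w; substituting c = (v - 1) A leaves
     the new [cle]. Multiplying by [a] then brings in [aw], and [A] cancels. *)
  move=> cle; have {}cle : (v - 2) * A <= (v - 2) * w by lra.
  have v2 : 0 < v - 2 by lra.
  move: cle; rewrite ler_pM2l // => /(ler_wpM2l (ltW a0)).
  by rewrite aw mulrA ler_pM2r.
have : (v - 2) * (a + b) ^+ n.-1 + A <= c * 2.
  rewrite -[c * 2]add0r -[X in _ <= X + _]e_eq -(Ueq _ p2) -lee_fin -esum2.
  (* [H] indicates that no opponent goes beyond {1}; on other profiles it is enough that the gain is
     nonnegative. *)
  pose H X : R := [forall (j | j != i), X j \in [:: fset0; seg 1]]%:R.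
  apply: (@le_trans _ _ (opp_esum prof i (fun X =>
      (v - 2) * H X + (X == nobody)%:R))); last first.
    apply: le_opp_esum => X Xi w; rewrite /H; case: forall_inP => [X01|_].
      rewrite mulr1; apply: gain_seg2_ge => // j /X01; rewrite !inE.
      by case/orP => /eqP; [left|right].
    (* [H] is in fact 1 at [nobody]; instead of refuting this case, the gain bound (v - 2) + 1 >= 1
       settles it. *)
    have [->|Xn] := eqVneq X nobody.
      rewrite mulr0 add0r; apply: le_trans _ (gain_seg2_ge v i nobody _ _).
      - by rewrite eqxx lerDr.
      - by move=> j _; left; rewrite ffunE.
      - by rewrite ffunE.
    rewrite mulr0 addr0; apply: gain_ge0 => d; rewrite setat_same mem_seg.
    by rewrite -(ler_nat R); lra.
  rewrite opp_esumD => [|X|X]; rewrite ?mulr_ge0 ?ler0n //.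
  rewrite opp_esumZ // opp_esum_point ?ffunE // opp_weight_nobody EFinD EFinM.
  by apply: leeD => //; apply: lee_wpmul2l => //; exact: opp_esum_atmost1.
have := exprD_ge94 a b n.-1 n1 (ltW a0) ab.
move=> /(ler_wpM2l v20); rewrite -/A -eqA => h1 h2.
(* With c = (v - 1) A, [h1] and [h2] combine to (v - 6) A <= 0. This product supplies the term v A,
   which linear arithmetic treats as an atom. *)
have : 0 < (v - 10) * A by rewrite mulr_gt0 ?subr_gt0.
by lra.
Qed.

End SymmetricMonotone.

Theorem theorem3p3 (R : realType) (n : nat) (v c : R)
    (hv : 0 < v) (hc : 0 < c) (hn : (3 <= n)%N)
    (hvc : Num.max (2 * c + 2) 10 < v) :
  ~ exists sigma : mixed_strategy R,
      monotone_strategy sigma /\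
      nash_equilibrium v c (fun _ : 'I_n => sigma).
Proof.
case=> sigma [mono]; move: hvc; rewrite gt_max => /andP[v_gt v_gt10].
exact: no_monotone_equilibrium.
Qed.
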